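(* If $S$ is a chaotic Delone subset of $\mathbb{R}$, then $S^n=S\times\cdots\times S$ is a chaotic Delone subset of $\mathbb{R}^n$ for every $n\geq 1$.
   Context: For $\epsilon,\delta>0$ and $m\ge1$, a subset $S$ of $\mathbb{R}^m$ (Euclidean metric) is $(\epsilon,\delta)$-Delone if for every $x\in\mathbb{R}^m$ there is $y\in S$ with $d(x,y)\leq\epsilon$, and $d(x,y)\geq\delta$ for all distinct $x,y\in S$; it is Delone if it is $(\epsilon,\delta)$-Delone for some $\epsilon,\delta>0$. The set $\operatorname{Del}_{\epsilon,\delta}$ of $(\epsilon,\delta)$-Delone subsets of $\mathbb{R}^m$ carries the local rubber topology, a compact metrisable topology induced by the uniformity with base of entourages $$N_{U,U'}=\{(S,S')\mid S\cap U\subset S'+U',\ S'\cap U\subset S+U'\},$$ with $U,U'$ open neighbourhoods of the origin and $U$ precompact. $\mathbb{R}^m$ acts continuously on it by $(v,S)\mapsto S-v$. Denote by $[S]$ the orbit of $S$ and by $\overline{[S]}$ its closure. A Delone set is periodic if its orbit is compact (equivalently, its stabilizer in $\mathbb{R}^m$ is a lattice); such an orbit is a periodic orbit. $S$ is almost chaotic if the union of the periodic orbits contained in $\overline{[S]}$ is dense in $\overline{[S]}$; it is aperiodic if $S-v\neq S$ for all $v\in\mathbb{R}^m\setminus\{0\}$; it is chaotic if it is almost chaotic and aperiodic. *)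

(* Defs.v *)
From HB Require Import structures.
From mathcomp Require Import all_boot all_order all_algebra.
From mathcomp Require Import all_classical all_reals all_analysis.

Set Implicit Arguments.
Unset Strict Implicit.
Unset Printing Implicit Defensive.

Import Order.TTheory GRing.Theory Num.Theory.
Import numFieldNormedType.Exports.

Local Open Scope classical_set_scope.
Local Open Scope ring_scope.

(* The norm and the balls that MathComp-Analysis puts on ['rV[R]_m] are those of
   the sup norm, hence this explicit Euclidean distance. Open and precompact
   sets are the same for both. *)
Definition edist (R : realType) (m : nat) (x y : 'rV[R]_m) : R :=
  Num.sqrt (\sum_(i < m) (x ord0 i - y ord0 i) ^+ 2).

Definition is_delone (R : realType) (m : nat) (eps delta : R)
    (S : set 'rV[R]_m) : Prop :=
  [/\ 0 < eps, 0 < delta,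
      forall x, exists2 y, S y & edist x y <= eps &
      forall x y, S x -> S y -> x <> y -> delta <= edist x y].

Record Del (R : realType) (m : nat) (eps delta : R) := MkDel {
  del_set :> set 'rV[R]_m ;
  del_delone : is_delone eps delta del_set }.

HB.instance Definition _ (R : realType) m (eps delta : R) :=
  gen_eqMixin (Del m eps delta).
HB.instance Definition _ (R : realType) m (eps delta : R) :=
  gen_choiceMixin (Del m eps delta).

Definition minkowski_add (V : zmodType) (A B : set V) : set V :=
  [set x + y | x in A & y in B].

Definition rubber_nbhd (R : realType) (m : nat) (eps delta : R)
    (U U' : set 'rV[R]_m) : set (Del m eps delta * Del m eps delta) :=
  [set p : Del m eps delta * Del m eps delta |
     p.1 `&` U `<=` minkowski_add p.2 U' /\
     p.2 `&` U `<=` minkowski_add p.1 U'].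
Arguments rubber_nbhd {R m} eps delta U U'.

Definition rubber_entourage (R : realType) (m : nat) (eps delta : R) :
    set_system (Del m eps delta * Del m eps delta) :=
  [set E | exists U U' : set 'rV[R]_m,
     [/\ open U, U 0, precompact U, open U' & U' 0] /\
     rubber_nbhd eps delta U U' `<=` E].
Arguments rubber_entourage {R} m eps delta.

Section rubber_uniformity.
Variables (R : realType) (m : nat) (eps delta : R).
Local Notation ent := (rubber_entourage m eps delta).
Local Open Scope relation_scope.

Let precompact_ball (r : R) : precompact (ball (0 : 'rV[R]_m) r).
Proof.
rewrite precompactE; apply: bounded_closed_compact; last exact: closed_closure.
exists r; split; first exact: num_real.
move=> M rM x clx.
have [y [yr]] := clx _ (nbhsx_ballx x (M - r) ltac:(by rewrite subr_gt0)).
rewrite -ball_normE /ball_ /= => yx.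
move: yr; rewrite -ball_normE /ball_ /= sub0r normrN => yr.
rewrite -(subrK y x) (le_trans (ler_normD _ _))//.
by rewrite -(subrK r M) lerD// ltW.
Qed.

Let rubber_nbhdS (U V U' V' : set 'rV[R]_m) : U `<=` V -> V' `<=` U' ->
  rubber_nbhd eps delta V V' `<=` rubber_nbhd eps delta U U'.
Proof.
move=> UV VU [S T] [/= ST TS]; split => /= x [xS xU].
- have [s ss [t tt <-]] := ST x (conj xS (UV _ xU)).
  by exists s => //; exists t => //; exact: VU.
- have [s ss [t tt <-]] := TS x (conj xS (UV _ xU)).
  by exists s => //; exists t => //; exact: VU.
Qed.

Let ent_filter : Filter ent.
Proof.
split.
- exists (ball 0 1), (ball 0 1); split => //.
  by split=> //; [exact: ball_open|exact: ballxx|exact: ball_open|exact: ballxx].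
- move=> A B [U [U' [[oU U0 pU oU' U'0] UA]]] [V [V' [[oV V0 pV oV' V'0] VB]]].
  exists (U `|` V), (U' `&` V'); split.
    split; [exact: openU|by left| |exact: openI|by []].
    move: pU pV; rewrite !precompactE closureU; exact: compactU.
  move=> p Np; split.
    by apply: UA; apply: rubber_nbhdS Np; [exact: subsetUl|exact: subIsetl].
  by apply: VB; apply: rubber_nbhdS Np; [exact: subsetUr|exact: subIsetr].
- move=> A B AB [U [U' [h UA]]]; exists U, U'; split => //.
  exact: subset_trans AB.
Qed.

Let ent_diagonal A : ent A -> diagonal `<=` A.
Proof.
move=> [U [U' [[oU U0 pU oU' U'0] UA]]] [S T] /= ST; apply: UA.
rewrite /diagonal /= in ST; rewrite -ST.
by split => x [xS _]; exists x => //; exists 0 => //; rewrite addr0.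
Qed.

Let ent_inv A : ent A -> ent A^-1.
Proof.
move=> [U [U' [h UA]]]; exists U, U'; split => //.
by move=> [S T] [/= ST TS]; apply: UA.
Qed.

Let ent_split_ex A : ent A -> exists2 B, ent B & B \; B `<=` A.
Proof.
move=> [U [U' [[oU U0 pU oU' U'0] UA]]].
have [M [Mreal UM]] : bounded_set U.
  move: pU; rewrite precompactE => /compact_bounded [M [Mr MU]].
  by exists M; split => // x Mx y Uy; apply: MU => //; exact: subset_closure.
have /nbhs_ballP [r /= r0 rU'] : nbhs (0 : 'rV[R]_m) U' by exact: open_nbhs_nbhs.
pose V := ball (0 : 'rV[R]_m) (`|M| + 1 + 1 + r).
pose V' := ball (0 : 'rV[R]_m) (r / 2).
have inV (x y : 'rV[R]_m) : U (x + y) -> V' y -> V x.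
  move=> Uxy; rewrite /V /V' -!ball_normE /ball_ /= !sub0r !normrN => yr.
  have : `|x + y| <= `|M| + 1.
    by apply: UM => //; rewrite (le_lt_trans (ler_norm M))// ltrDl.
  move=> xyM; rewrite -(addrK y x) (le_lt_trans (ler_normB _ _))//.
  rewrite -(addrA _ 1 r) ler_ltD// (lt_le_trans yr)//.
  by rewrite ler_wpDl// ler_pdivrMr// ler_peMr ?ler1n// ltW.
have subV : U `<=` V.
  move=> x Ux; apply: (inV x 0); first by rewrite addr0.
  by apply: ballxx; rewrite divr_gt0.
have addV' (x y : 'rV[R]_m) : V' x -> V' y -> U' (x + y).
  move=> xr yr; apply: rU'; move: xr yr.
  rewrite /V' -!ball_normE /ball_ /= !sub0r !normrN => xr yr.
  by rewrite (le_lt_trans (ler_normD _ _))// (splitr r) ltrD.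
have comp (S T W : set 'rV[R]_m) : S `&` V `<=` minkowski_add T V' ->
    T `&` V `<=` minkowski_add W V' -> S `&` U `<=` minkowski_add W U'.
  move=> ST TW x [xS xU].
  have [t tT [v vV' tv]] := ST _ (conj xS (subV _ xU)).
  rewrite -tv in xU *.
  have [w wW [u uV' <-]] := TW _ (conj tT (inV _ _ xU vV')).
  by exists w => //; exists (u + v); rewrite ?addrA//; exact: addV'.
exists (rubber_nbhd eps delta V V').
  exists V, V'; split => //; split.
  - exact: ball_open.
  - exact: subV.
  - exact: precompact_ball.
  - exact: ball_open.
  - by apply: ballxx; rewrite divr_gt0.
move=> [S W] [T [/= ST TS] [/= TW WT]]; apply: UA; split => /=.
  exact: comp ST TW.
exact: comp WT TS.
Qed.

HB.instance Definition _ := @isUniform.Build (Del m eps delta) ent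
  ent_filter ent_diagonal ent_inv ent_split_ex.

End rubber_uniformity.

Section translation_action.
Variables (R : realType) (m : nat) (eps delta : R).

Lemma is_delone_translate (v : 'rV[R]_m) (S : Del m eps delta) :
  is_delone eps delta [set x - v | x in S].
Proof.
have distB (x y : 'rV[R]_m) : edist (x - v) (y - v) = edist x y.
  congr Num.sqrt; apply: eq_bigr => i _; congr (_ ^+ 2).
  by rewrite !mxE opprB addrA subrK.
have [e0 d0 cov sep] := del_delone S; split => //.
- move=> x; have [y Sy xy] := cov (x + v).
  by exists (y - v); [exists y|rewrite -(addrK v x) distB].
- move=> _ _ [x Sx <-] [y Sy <-] xy; rewrite distB; apply: sep => //.
  by move=> exy; apply: xy; rewrite exy.
Qed.

Definition translate (v : 'rV[R]_m) (S : Del m eps delta) : Del m eps delta :=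
  MkDel (is_delone_translate v S).

Definition translation_orbit (S : Del m eps delta) : set (Del m eps delta) :=
  [set translate v S | v in setT].

Definition periodic (S : Del m eps delta) : Prop := compact (translation_orbit S).

Definition periodic_orbit (O : set (Del m eps delta)) : Prop :=
  exists2 P : Del m eps delta, periodic P & O = translation_orbit P.

Definition almost_chaotic (S : Del m eps delta) : Prop :=
  closure (translation_orbit S) `<=`
  closure (\bigcup_(O in [set O | periodic_orbit O /\
                                  O `<=` closure (translation_orbit S)]) O).

Definition aperiodic (S : Del m eps delta) : Prop :=
  forall v : 'rV[R]_m, v != 0 -> translate v S <> S :> set _.

Definition chaotic (S : Del m eps delta) : Prop :=
  almost_chaotic S /\ aperiodic S.

End translation_action.

(* The choice of [eps] and [delta] is immaterial: each [Del m eps delta] is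
   compact, so the orbit closure of [S] and its topology do not depend on which
   [Del m eps delta] containing [S] they are computed in. *)
Definition chaotic_delone (R : realType) (m : nat) (S : set 'rV[R]_m) : Prop :=
  exists (eps delta : R) (T : Del m eps delta), T = S :> set _ /\ chaotic T.

Definition cartesian_power (R : realType) (n : nat) (S : set R) :
    set 'rV[R]_n :=
  [set x | forall i, S (x ord0 i)].
Arguments cartesian_power {R} n S.

(* Main.v *)
From mathcomp Require Import all_boot all_order all_algebra.
From mathcomp Require Import all_classical all_reals all_analysis.
Require Import Defs.

(** Write [box P] for the product of subsets [P i] of the line; [S^n] is the
    box with all factors [S].  Chaoticity passes to products because everything
    about the translation action splits coordinatewise on boxes.

    A product of n Delone sets is Delone ([is_delone_box]), and the product map
    from the n-fold power of the space of Delone subsets of the line is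
    uniformly continuous ([entourage_box]): whether two boxes are close near the
    origin is decided one coordinate at a time.  Moreover the vector [v] moves
    the i-th factor by its i-th coordinate alone, and these coordinates are
    independent.  Hence the orbit of a box is exactly the image, under the
    product map, of the product of the orbits of its factors
    ([translation_orbit_box]).

    The statement follows.  By Tychonoff's theorem a product of periodic sets
    has compact orbit ([periodic_box]).  Given a translate of [S^n], that is a
    box of translates of [S], approximate each factor by a periodic set in the
    orbit closure of [S]: the box of the approximants is periodic, lies in the
    orbit closure of [S^n] and is close to the given translate
    ([almost_chaotic_box]).  Finally a nonempty box determines its factors, so a
    period of [S^n] has every coordinate a period of [S], hence is zero
    ([aperiodic_box]). *)

Set Implicit Arguments.
Unset Strict Implicit.
Unset Printing Implicit Defensive.

Import Order.TTheory GRing.Theory Num.Theory.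
Import numFieldNormedType.Exports.

Local Open Scope classical_set_scope.
Local Open Scope ring_scope.

Lemma del_set_inj (R : realType) m (eps delta : R) (S T : Del m eps delta) :
  S = T :> set _ -> S = T.
Proof.
case: S T => [S dS] [T dT] /= ST; subst T; congr MkDel; exact: Prop_irrelevance.
Qed.

Section box.
Variables (R : realType) (n : nat).
Implicit Types (x y v : 'rV[R]_n) (P Q : 'I_n -> set 'rV[R]_1).

Definition row_of_cols (a : 'I_n -> 'rV[R]_1) : 'rV[R]_n :=
  \row_i a i ord0 ord0.

Lemma col_row_of_cols a i : col i (row_of_cols a) = a i.
Proof. by apply/matrixP => j k; rewrite !mxE !ord1. Qed.

Lemma row_of_colsK x : row_of_cols (fun i => col i x) = x.
Proof. by apply/rowP => j; rewrite !mxE. Qed.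

(** Factors are sets of row vectors of length 1 rather than sets of scalars, so
    that [Del 1] applies to them; [col i x] is the i-th coordinate of [x] in
    that form. *)
Definition box P : set 'rV[R]_n := [set x | forall i, P i (col i x)].

(** A point of one factor extends to a point of the box because the other
    factors are inhabited; an empty factor would erase all the others. *)
Lemma box_inj P Q : (forall i, P i !=set0) -> (forall i, Q i !=set0) ->
  box P = box Q -> forall i, P i = Q i.
Proof.
wlog suff sub : P Q / (forall i, P i !=set0) -> box P = box Q ->
    forall i, P i `<=` Q i.
  move=> P0 Q0 PQ i.
  by apply/seteqP; split; apply: sub => //; rewrite PQ.
move=> /choice[p Pp] PQ i a Pa.
(* The extension of [a]: an arbitrary point in every other factor. *)
pose b j := if j == i then a else p j.
have : box P (row_of_cols b).
  by move=> j; rewrite col_row_of_cols /b; case: eqP => [->|].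
by rewrite PQ => /(_ i); rewrite col_row_of_cols /b eqxx.
Qed.

Lemma translate_box v P :
  [set x - v | x in box P] = box (fun i => [set a - col i v | a in P i]).
Proof.
apply/seteqP; split => [_ [x Px <-] i|x Px].
  by exists (col i x) => //; rewrite raddfB.
exists (x + v); last by rewrite addrK.
by move=> i; have [a Pa ax] := Px i; rewrite raddfD/= -ax subrK.
Qed.

Lemma edist_col x y i : edist (col i x) (col i y) = `|x ord0 i - y ord0 i|.
Proof. by rewrite /edist big_ord1 !mxE sqrtr_sqr. Qed.

Lemma edist_col_le x y i : edist (col i x) (col i y) <= edist x y.
Proof.
rewrite /edist big_ord1 !mxE ler_sqrt; last first.
  by apply: sumr_ge0 => j _; exact: sqr_ge0.
by rewrite (bigD1 i)//= lerDl sumr_ge0// => j _; exact: sqr_ge0.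
Qed.

Lemma edist_le_sqrt x y (e : R) : 0 <= e ->
  (forall i, edist (col i x) (col i y) <= e) ->
  edist x y <= Num.sqrt n%:R * e.
Proof.
move=> e0 xy; rewrite -[X in _ * X]ger0_norm// -sqrtr_sqr -sqrtrM ?ler0n//.
rewrite ler_wsqrtr// mulr_natl -[n in X in _ <= X]card_ord -sumr_const.
apply: ler_sum => i _; move: (xy i); rewrite edist_col => xyi.
by rewrite -real_normK ?num_real// ler_pXn2r// nnegrE.
Qed.

(** The covering radius adds up as a Euclidean diagonal over the n coordinates,
    whereas distinct points of the box already differ by [delta] in a single
    coordinate. *)
Lemma is_delone_box (eps delta : R) P : (0 < n)%N ->
  (forall i, is_delone eps delta (P i)) ->
  is_delone (Num.sqrt n%:R * eps) delta (box P).
Proof.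
move=> n0 dP; have [eps0 delta0 _ _] := dP (Ordinal n0).
split => //; first by rewrite mulr_gt0// sqrtr_gt0 ltr0n.
- move=> x.
  have /choice[a Pa] : forall i, exists a, P i a /\ edist (col i x) a <= eps.
    move=> i; have [_ _ cov _] := dP i.
    by have [a] := cov (col i x); exists a.
  exists (row_of_cols a).
    by move=> i; rewrite col_row_of_cols; have [] := Pa i.
  apply: edist_le_sqrt; first exact: ltW.
  by move=> i; rewrite col_row_of_cols; have [] := Pa i.
- move=> x y Px Py xy.
  have [i xyi] : exists i, col i x <> col i y.
    apply: contrapT => /forallNP cxy; apply: xy.
    rewrite -(row_of_colsK x) -(row_of_colsK y); congr row_of_cols.
    by apply/funext => i; apply: contrapT.
  have [_ _ _ sep] := dP i.
  by apply: le_trans (edist_col_le x y i); exact: sep.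
Qed.

(** The norm on row vectors is the sup norm, so balls are cubes; this is what
    makes the basic entourages compatible with products. *)
Lemma ball0_col (r : R) x : 0 < r ->
  ball 0 r x <-> forall i, ball 0 r (col i x).
Proof.
move=> r0; split=> [[_ xr] i|xr]; split=> // j k.
  by have := xr j i; rewrite !mxE.
by have [_ /(_ j ord0)] := xr k; rewrite !mxE.
Qed.

Lemma minkowski_add_box P Q :
  box (fun i => minkowski_add (P i) (Q i)) `<=` minkowski_add (box P) (box Q).
Proof.
move=> x PQx.
have /choice[a Pa] : forall i, exists a, P i a /\ Q i (col i x - a).
  by move=> i; have [a Pa [b Qb <-]] := PQx i; exists a; rewrite addrC addKr.
exists (row_of_cols a); first by move=> i; rewrite col_row_of_cols; case: (Pa i).
exists (x - row_of_cols a); last by rewrite addrC subrK.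
by move=> i; rewrite raddfB/= col_row_of_cols; case: (Pa i).
Qed.

End box.

Lemma precompact_ball0 (R : realType) m (r : R) : 0 < r ->
  precompact (ball (0 : 'rV[R]_m) r).
Proof.
move=> r0; rewrite precompactE; apply: bounded_closed_compact => //.
  exists r; split; first exact: num_real.
  move=> M rM x; rewrite -/(closed_ball _ _) closed_ballE//=.
  by rewrite /closed_ball_ /= sub0r normrN => /le_trans; apply; exact: ltW.
exact: closed_closure.
Qed.

Section box_delone.
Variables (R : realType) (n : nat) (eps delta : R).
Hypothesis n_gt0 : (0 < n)%N.
Implicit Types P Q : 'I_n -> Del 1 eps delta.

Definition del_box P : Del n (Num.sqrt n%:R * eps) delta :=
  MkDel (is_delone_box n_gt0 (fun i => del_delone (P i))).

(** Cubical windows and cubical tolerances make closeness of boxes a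
    coordinatewise matter, with no loss in the constants. *)
Lemma rubber_nbhd_box (M r : R) P Q : 0 < M -> 0 < r ->
  (forall i, rubber_nbhd eps delta (ball 0 M) (ball 0 r) (P i, Q i)) ->
  rubber_nbhd (Num.sqrt n%:R * eps) delta (ball 0 M) (ball 0 r)
    (del_box P, del_box Q).
Proof.
move=> M0 r0 PQ.
have incl (A B : 'I_n -> set 'rV[R]_1) :
    (forall i, A i `&` ball 0 M `<=` minkowski_add (B i) (ball 0 r)) ->
    box A `&` ball 0 M `<=` minkowski_add (box B) (ball 0 r).
  move=> AB x [Ax /(ball0_col _ M0) Mx].
  have /minkowski_add_box[a Ba [b rb <-]] :
      box (fun i => minkowski_add (B i) (ball 0 r)) x.
    by move=> i; apply: AB; split; [exact: Ax|exact: Mx].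
  by exists a => //; exists b => //; apply/(ball0_col _ r0).
by split; apply: incl => i; case: (PQ i).
Qed.

(** Uniform continuity of the product map: any precompact window fits in a cube
    and any tolerance contains one, which reduces to [rubber_nbhd_box]. *)
Lemma entourage_box E :
  entourage E -> exists2 D : set (Del 1 eps delta * Del 1 eps delta),
    entourage D &
    forall P Q, (forall i, D (P i, Q i)) -> E (del_box P, del_box Q).
Proof.
move=> [U [U' [[oU U0 pU oU' U'0] UE]]].
have [M M0 UM] : exists2 M : R, 0 < M & U `<=` ball 0 M.
  move: pU; rewrite precompactE => /compact_bounded [M [Mr MU]].
  (* The bound [M] only controls [U] by numbers strictly above it, and the ball
     is open, hence the two units of slack. *)
  exists (`|M| + 1 + 1) => [|x Ux]; first by rewrite !ltr_wpDl.
  rewrite -ball_normE /ball_ /= sub0r normrN.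
  rewrite (@le_lt_trans _ _ (`|M| + 1)) ?ltrDl//.
  apply: MU; last exact: subset_closure.
  by rewrite (le_lt_trans (ler_norm M))// ltrDl.
have /nbhs_ballP[r /= r0 rU'] : nbhs (0 : 'rV[R]_n) U' by exact: open_nbhs_nbhs.
exists (rubber_nbhd eps delta (ball 0 M) (ball 0 r)).
  exists (ball 0 M), (ball 0 r); split => //.
  split; [exact: ball_open|exact: ballxx|exact: precompact_ball0|
          exact: ball_open|exact: ballxx].
move=> P Q /(rubber_nbhd_box M0 r0)[PQ QP]; apply: UE.
split=> x [Sx /UM Ux].
  by have [a Qa [b /rU' U'b <-]] := PQ x (conj Sx Ux); exists a => //; exists b.
by have [a Pa [b /rU' U'b <-]] := QP x (conj Sx Ux); exists a => //; exists b.
Qed.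

Lemma del_box_continuous :
  continuous (del_box : prod_topology (fun=> Del 1 eps delta) -> _).
Proof.
move=> P; have FP := nbhs_filter (P : prod_topology (fun=> Del 1 eps delta)).
apply/(cvg_app_entourageP _ FP) => E /entourage_box[D entD DE].
have : \forall Q \near P, forall i, D (P i, Q i).
  apply: (@filter_forall _ _ _ _ FP) => i.
  have := @proj_continuous 'I_n (fun=> Del 1 eps delta) i P.
  by move/(cvg_app_entourageP _ FP); exact.
by apply: (@filterS _ _ FP) => Q; exact: DE.
Qed.

Lemma closure_del_box (A : 'I_n -> set (Del 1 eps delta)) P :
  (forall i, closure (A i) (P i)) ->
  closure [set del_box Q | Q in [set Q | forall i, A i (Q i)]] (del_box P).
Proof.
move=> clP B /nbhsP[E /entourage_box[D entD DE] EB].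
have /choice[Q AQ] : forall i, exists X, A i X /\ D (P i, X).
  move=> i; have [X [AX]] := clP i _ (nbhs_entourage (P i) entD).
  by rewrite /xsection/= inE => DX; exists X.
exists (del_box Q); split; first by exists Q => // i; case: (AQ i).
by apply: EB; rewrite /xsection/= inE; apply: DE => i; case: (AQ i).
Qed.

Lemma translate_del_box v P :
  translate v (del_box P) = del_box (fun i => translate (col i v) (P i)).
Proof. by apply: del_set_inj; exact: translate_box. Qed.

(** The coordinates of a translation vector can be prescribed independently, so
    every tuple of translates of the factors is reached by one vector. *)
Lemma translation_orbit_box P :
  translation_orbit (del_box P) =
  [set del_box Q | Q in [set Q | forall i, translation_orbit (P i) (Q i)]].
Proof.
apply/seteqP; split => [_ [v _ <-]|_ [Q /= PQ <-]].
  rewrite translate_del_box; exists (fun i => translate (col i v) (P i)) => //.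
  by move=> i; exists (col i v).
have /choice[v vQ] : forall i, exists v, translate v (P i) = Q i.
  by move=> i; have [v _ vQ] := PQ i; exists v.
exists (row_of_cols v) => //; rewrite translate_del_box; congr del_box.
by apply/funext => i; rewrite col_row_of_cols.
Qed.

Lemma periodic_box P : (forall i, periodic (P i)) -> periodic (del_box P).
Proof.
move=> perP; rewrite /periodic translation_orbit_box.
apply: (@continuous_compact (prod_topology (fun=> Del 1 eps delta))).
  exact/continuous_subspaceT/del_box_continuous.
exact: (@tychonoff _ (fun=> Del 1 eps delta)
  (fun i => translation_orbit (P i))).
Qed.

(** The orbit is enough, since the target is closed.  A tuple of approximants
    [Z i], each on a periodic orbit in the orbit closure of [P i], gives the box
    [del_box Z] on the orbit of a periodic box; that orbit stays in the orbit
    closure of [del_box P] because the product map is continuous. *)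
Lemma almost_chaotic_box P :
  (forall i, almost_chaotic (P i)) -> almost_chaotic (del_box P).
Proof.
move=> acP; rewrite /almost_chaotic.
set periodics := (X in _ `<=` closure X).
suff : translation_orbit (del_box P) `<=` closure periodics.
  by move/closureS; rewrite -(proj1 (closure_id _) (@closed_closure _ periodics)).
rewrite translation_orbit_box => _ [Q PQ <-].
have {acP} /closure_del_box : forall i, closure (\bigcup_(O in [set O |
    periodic_orbit O /\ O `<=` closure (translation_orbit (P i))]) O) (Q i).
  by move=> i; apply/acP/subset_closure/PQ.
apply: closureS => _ [Z /= PZ <-].
have /choice[W perW] : forall i, exists W, [/\ periodic W,
    translation_orbit W `<=` closure (translation_orbit (P i)) &
    translation_orbit W (Z i)].
  by move=> i; have [_ [[W perW ->] WP] WZ] := PZ i; exists W.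
exists (translation_orbit (del_box W)); last first.
  by rewrite translation_orbit_box; exists Z => // i; case: (perW i).
split.
  by exists (del_box W) => //; apply: periodic_box => i; case: (perW i).
rewrite !translation_orbit_box => _ [Y WY <-].
apply: (@closure_del_box (fun i => translation_orbit (P i))) => i.
by case: (perW i) => _ WP _; exact/WP/WY.
Qed.

Lemma aperiodic_box P : (forall i, aperiodic (P i)) -> aperiodic (del_box P).
Proof.
have del0 (S : Del 1 eps delta) : del_set S !=set0.
  by have [_ _ /(_ 0)[x Sx _] _] := del_delone S; exists x.
move=> apP v v0; rewrite translate_del_box => vP.
have [i vi0] : exists i, v ord0 i != 0 by apply/rV0Pn.
apply: (apP i (col i v)).
  by apply: contra vi0 => /eqP/matrixP/(_ ord0 ord0); rewrite !mxE => ->.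
by apply: (box_inj _ _ vP) => j; exact: del0.
Qed.

End box_delone.

Theorem proposition5p1 (R : realType) (S : set R) :
  chaotic_delone [set x : 'rV[R]_1 | S (x ord0 ord0)] ->
  forall n : nat, (1 <= n)%N -> chaotic_delone (cartesian_power n S).
Proof.
move=> [eps [delta [T [TS [acT apT]]]]] n n_gt0.
exists (Num.sqrt n%:R * eps), delta, (del_box n_gt0 (fun=> T)).
split; last by split; [exact: almost_chaotic_box|exact: aperiodic_box].
by apply/seteqP; split => x Sx i; have := Sx i; rewrite TS /= mxE.
Qed.
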